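(* Assume the exterior gap condition $$\operatorname{dist}\Big(\frac{\omega_0^2}{v^2},\ \sigma(-\Delta_{\mathrm{Dir}};\Omega_{\mathrm{ext}})\Big)>0 ,$$ and let $C_0,\beta,\mu>0$ be constants (which exist) such that for all integers $1\le N\le R$ and all $0<\gamma\le\gamma_0$, $$\big\|\mathcal C(\omega_0)-\widehat{\mathcal C}_{N,R,\gamma}\big\|_{\mathcal B(\ell^2(\mathcal I(\omega_0)))}\le C_0\big(\gamma^2+e^{-\beta N}+\gamma^{-1}e^{-\mu R}\big).$$ For all sufficiently large $R$ and integers $1\le N\le R$, choose $\gamma_R:=e^{-\mu R/3}$. Then, for some $C>0$ (independent of $N$ and $R$), $$\big\|\mathcal C(\omega_0)-\widehat{\mathcal C}_{N,R,\gamma_R}\big\|\le C\big(e^{-\beta N}+e^{-2\mu R/3}\big).$$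
   Context: Geometry. Let $d\in\{2,3\}$, let $e_1,\dots,e_d\in\mathbb R^d$ be linearly independent, $\Lambda=\{\sum_i j_ie_i: j_i\in\mathbb Z\}$ and $Y=\{\sum_i c_ie_i:0\le c_i<1\}$. Let $D,\widetilde D\Subset Y$ be bounded connected $C^{1,1}$-domains, let $v,v_b,\widetilde v_b>0$, and let $\mathcal J_{\mathrm{sh}},\mathcal J_{\mathrm{mat}}\subset\Lambda$, $\mathcal J_{\mathrm{def}}=\mathcal J_{\mathrm{sh}}\cup\mathcal J_{\mathrm{mat}}$. For $\mathbf j\in\Lambda$: $B_{\mathbf j}=\widetilde D$ if $\mathbf j\in\mathcal J_{\mathrm{sh}}$ and $B_{\mathbf j}=D$ otherwise; $v_{\mathbf j}=\widetilde v_b$ if $\mathbf j\in\mathcal J_{\mathrm{mat}}$ and $v_{\mathbf j}=v_b$ otherwise; $D_{\mathbf j}=B_{\mathbf j}+\mathbf j$. Set $\mathcal D=\bigcup_{\mathbf j}D_{\mathbf j}$ and $\Omega_{\mathrm{ext}}=\mathbb R^d\setminus\overline{\mathcal D}$. The normal $\nu$ points out of $D_{\mathbf j}$; $+$ denotes the exterior trace. $-\Delta_{\mathrm{Dir}}$ is the Dirichlet Laplacian in $\Omega_{\mathrm{ext}}$, with spectrum $\sigma$ and resolvent set $\rho$. Resonant modes. $m_{\mathbf j}=\dim E_{\mathbf j}(\omega_0)$, $E_{\mathbf j}(\omega_0)=\ker(-\Delta_{\mathrm{Neu},D_{\mathbf j}}-\omega_0^2/v_{\mathbf j}^2)$, where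 $-\Delta_{\mathrm{Neu},D_{\mathbf j}}$ is the Neumann Laplacian. The reference frequency $\omega_0\ne0$ (real) is fixed with $m_{\mathbf j}=0$ for every $\mathbf j\notin\mathcal J_{\mathrm{def}}$ and $m_{\mathbf k}>0$ for some $\mathbf k\in\mathcal J_{\mathrm{def}}$. $\{u_{\mathbf j,\ell}\}_{\ell=1}^{m_{\mathbf j}}$ is an $L^2(D_{\mathbf j})$-orthonormal basis of $E_{\mathbf j}(\omega_0)$ and $\mathcal I(\omega_0)=\{(\mathbf j,\ell):\mathbf j\in\Lambda,1\le\ell\le m_{\mathbf j}\}$. Capacitance operator. For $(\mathbf j,\ell)\in\mathcal I(\omega_0)$, $U_{\mathbf j,\ell}\in H^1(\Omega_{\mathrm{ext}})$ is the unique solution of $(\Delta+\omega_0^2/v^2)U_{\mathbf j,\ell}=0$ in $\Omega_{\mathrm{ext}}$, $U_{\mathbf j,\ell}=u_{\mathbf j,\ell}$ on $\partial D_{\mathbf j}$, $U_{\mathbf j,\ell}=0$ on $\partial D_{\mathbf j'}$ for $\mathbf j'\neq\mathbf j$. $\mathcal C(\omega_0)$ is the bounded self-adjoint operator on $\ell^2(\mathcal I(\omega_0))$ with entries $\mathcal C_{(\mathbf j,\ell),(\mathbf j',\ell')}(\omega_0)=-\frac{v_{\mathbf j}v_{\mathbf j'}}{2\omega_0}\int_{\partial D_{\mathbf j}}\partial_\nu U_{\mathbf j',\ell'}|_+\,\overline{u_{\mathbf j,\ell}}\,d\sigma$. Complex shift. Let $z_0=\omega_0^2$; fix $r>0$ with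 $\overline{B(z_0,r)}\subset\{z\in\mathbb C:z/v^2\in\rho(-\Delta_{\mathrm{Dir}};\Omega_{\mathrm{ext}})\}$, $0<\gamma_0<r$, and $z_\gamma=z_0+\mathrm i\gamma$ for $0<\gamma\le\gamma_0$. Finite clusters. For $\mathbf j'\in\Lambda$, $R\ge1$: $\Lambda_{\mathbf j'}^R=\{\mathbf k\in\Lambda:|\mathbf k-\mathbf j'|\le R\}$ and $\Omega_{\mathbf j'}^{R,\mathrm{fc}}=\mathbb R^d\setminus\overline{\bigcup_{\mathbf k\in\Lambda_{\mathbf j'}^R}D_{\mathbf k}}$. For $(\mathbf j',\ell')\in\mathcal I(\omega_0)$, $U_{\mathbf j',\ell'}^{R,\gamma}\in H^1(\Omega_{\mathbf j'}^{R,\mathrm{fc}})$ is the unique solution of $(\Delta+z_\gamma/v^2)U_{\mathbf j',\ell'}^{R,\gamma}=0$ in $\Omega_{\mathbf j'}^{R,\mathrm{fc}}$, equal to $u_{\mathbf j',\ell'}$ on $\partial D_{\mathbf j'}$ and to $0$ on $\partial D_{\mathbf k}$, $\mathbf k\in\Lambda_{\mathbf j'}^R\setminus\{\mathbf j'\}$. For integers $1\le N\le R$, $$\big(\mathcal C_{N,R,\gamma}^{\mathrm{fc}}\big)_{(\mathbf j,\ell),(\mathbf j',\ell')}=\begin{cases}-\dfrac{v_{\mathbf j}v_{\mathbf j'}}{2\omega_0}\big\langle\partial_\nu U_{\mathbf j',\ell'}^{R,\gamma}|_+,u_{\mathbf j,\ell}\big\rangle_{H^{-1/2}(\partial D_{\mathbf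 j}),H^{1/2}(\partial D_{\mathbf j})},&|\mathbf j-\mathbf j'|\le N,\\0,&|\mathbf j-\mathbf j'|>N,\end{cases}$$ and $\widehat{\mathcal C}_{N,R,\gamma}=\frac12\big(\mathcal C_{N,R,\gamma}^{\mathrm{fc}}+(\mathcal C_{N,R,\gamma}^{\mathrm{fc}})^*\big)$. *)

(* Defs.v *)
From HB Require Import structures.
From mathcomp Require Import all_boot all_order all_algebra.
From mathcomp Require Import complex.
From mathcomp Require Import all_classical all_reals all_analysis.
Import Order.TTheory GRing.Theory Num.Theory.
Import numFieldNormedType.Exports.

Set Implicit Arguments.
Unset Strict Implicit.
Unset Printing Implicit Defensive.

Local Open Scope classical_set_scope.
Local Open Scope ring_scope.
Local Open Scope complex_scope.

Section CoverMeasure.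
Local Open Scope ereal_scope.
Context (R : realType) (T : Type).
Implicit Types (g : set T -> \bar R) (X : set T).

Definition cover_cost g X : \bar R := if `[< X = set0 >] then 0 else g X.

(* The outer measure with gauge [g] over countable covers; a gauge value +oo
   excludes a set from the covers. *)
Definition cover_measure g X : \bar R :=
  ereal_inf [set \sum_(k <oo) cover_cost g (A k)
            | A in [set A : (set T)^nat | X `<=` \bigcup_k A k]].

Context (g : set T -> \bar R).
Hypothesis g_ge0 : forall X, 0 <= g X.

Lemma cover_cost_ge0 X : 0 <= cover_cost g X.
Proof. by rewrite /cover_cost; case: ifP. Qed.

Lemma cover_cost0 : cover_cost g set0 = 0.
Proof. by rewrite /cover_cost asboolT. Qed.

#[local] Hint Resolve cover_cost_ge0 : core.

Lemma le_cover_measure : {homo cover_measure g : A B / A `<=` B >-> A <= B}.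
Proof.
move=> A B AB; apply/ereal_inf_le_tmp => x [B' BB' <-{x}].
by exists B' => //; apply: subset_trans AB BB'.
Qed.

Lemma cover_measure_ge0 A : 0 <= cover_measure g A.
Proof. by apply: le_ereal_inf_tmp => x [B AB <-{x}]; exact: nneseries_ge0. Qed.

Lemma cover_measure0 : cover_measure g set0 = 0.
Proof.
apply/eqP; rewrite eq_le; apply/andP; split; last exact/cover_measure_ge0.
apply: ereal_inf_lbound; exists (fun=> set0) => //.
by apply: eseries0 => n _ _; exact: cover_cost0.
Qed.

Lemma cover_measure_sigma_subadditive : sigma_subadditive (cover_measure g).
Proof.
move=> A; have [[i ioo]|] := pselect (exists i, cover_measure g (A i) = +oo).
  rewrite (eseries_pinfty _ _ ioo) ?leey// => n _.
  by rewrite -ltNye (lt_le_trans _ (cover_measure_ge0 _)).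
rewrite -forallNE => Aoo.
suff add2e (e : {posnum R}) : cover_measure g (\bigcup_n A n) <=
    \sum_(i <oo) cover_measure g (A i) + e%:num%:E.
  by apply/lee_addgt0Pr => _/posnumP[].
rewrite (le_trans _ (epsilon_trick _ _ _))//; last first.
  by move=> n; exact: cover_measure_ge0.
pose c := cover_cost g.
pose P n (B : (set T)^nat) := A n `<=` \bigcup_k B k /\
  \sum_(k <oo) c (B k) <= cover_measure g (A n) + (e%:num / (2 ^ n.+1)%:R)%:E.
have [G PG] : {G : ((set T)^nat)^nat & forall n, P n (G n)}.
  apply: (@choice _ _ P) => n; rewrite /P /cover_measure.
  set S := (X in ereal_inf X); move infS : (ereal_inf S) => iS.
  case: iS infS => [r Sr|Soo|Soo].
  - have en1 : (0 < e%:num / (2 ^ n.+1)%:R)%R by [].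
    have /(lb_ereal_inf_adherent en1) : ereal_inf S \is a fin_num by rewrite Sr.
    move=> [x [B AnB muBx] xS].
    by exists B; split => //; rewrite muBx -Sr; exact/ltW.
  - by have := Aoo n; rewrite /cover_measure Soo.
  - suff : lbound S 0 by move/le_ereal_inf_tmp; rewrite Soo.
    by move=> /= _ [B AnB <-]; exact: nneseries_ge0.
have cG_ge0 x : 0 <= (c \o uncurry G) x by exact: cover_cost_ge0.
apply: (@le_trans _ _ (\esum_(i in setT) (c \o uncurry G) i)).
  apply: ereal_inf_lbound => /=.
  have /card_esym/ppcard_eqP[f] := card_nat2.
  exists (uncurry G \o f).
    apply: (@subset_trans _  (\bigcup_n \bigcup_k G n k)) => [t [i _]|].
      by move=> /((PG i).1) -[j _ ?]; exists i => //; exists j.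
    move=> t [i _ [j _ Bijt]]; exists (f^-1%FUN (i, j)) => //=.
    by rewrite invK ?inE.
  rewrite -(esum_pred_image (c \o uncurry G) _ xpredT) ?[fun=> _]set_true//.
  by rewrite image_eq.
rewrite (_ : esum _ _ = \sum_(i <oo) \sum_(j <oo ) c (G i j)); last first.
  pose J : nat -> set (nat * nat) := fun i => [set (i, j) | j in setT].
  rewrite (_ : setT = \bigcup_k J k); last first.
    by rewrite predeqE => -[a b]; split => // _; exists a => //; exists b.
  rewrite esum_bigcupT /=; last 2 first.
    - apply/trivIsetP => i j _ _ ij.
      rewrite predeqE => -[n m] /=; split => //= -[] [_] _ [<-{n} _].
      by move=> [m' _] [] /esym/eqP; rewrite (negbTE ij).
    - by move=> /= [n m]; exact: cover_cost_ge0.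
  rewrite -(image_id [set: nat]) -fun_true esum_pred_image//; last first.
    by move=> n _; exact: esum_ge0.
  apply: eq_eseriesr => /= j _.
  rewrite -(esum_pred_image (c \o uncurry G) (pair j) predT)//=; last first.
    by move=> ? ? _ _; exact: (@can_inj _ _ _ snd).
  by congr esum; rewrite predeqE => -[a b]; split; move=> [i _ <-]; exists i.
apply: lee_lim.
- apply: is_cvg_nneseries => n *.
  by apply: nneseries_ge0 => m *; exact: (cG_ge0 (n, m)).
- by apply: is_cvg_nneseries => n *; apply: adde_ge0 => //;
    exact: cover_measure_ge0.
- by near=> n; apply: lee_sum => i _; exact: (PG i).2.
Unshelve. all: by end_near. Qed.

End CoverMeasure.

Section EuclideanMeasures.
Context (R : realType).

(* The library norm of ['rV[R]_d] is the sup norm. *)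
Definition dotv d (x y : 'rV[R]_d) : R := \sum_i x 0 i * y 0 i.
Definition enorm d (x : 'rV[R]_d) : R := Num.sqrt (dotv x x).

Local Open Scope ereal_scope.

Definition box_gauge d (X : set 'rV[R]_d) : \bar R :=
  ereal_inf [set (\prod_i (ab.2 0%R i - ab.1 0%R i))%R%:E
    | ab in [set ab : 'rV[R]_d * 'rV[R]_d
            | (forall i, ab.1 0%R i <= ab.2 0%R i)%R /\
              X `<=` [set x | forall i,
                      (ab.1 0%R i <= x 0%R i <= ab.2 0%R i)%R]]].

Definition lebesgue_outer d : set 'rV[R]_d -> \bar R :=
  cover_measure (@box_gauge d).

Lemma box_gauge_ge0 d (X : set 'rV[R]_d) : 0 <= box_gauge X.
Proof.
apply: le_ereal_inf_tmp => _ [[a b] /= [ab _] <-].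
by rewrite lee_fin prodr_ge0// => i _; rewrite subr_ge0.
Qed.

HB.instance Definition _ d :=
  isOuterMeasure.Build R 'rV[R]_d (@lebesgue_outer d)
    (cover_measure0 (@box_gauge_ge0 d)) (cover_measure_ge0 (@box_gauge_ge0 d))
    (@le_cover_measure _ _ _)
    (cover_measure_sigma_subadditive (@box_gauge_ge0 d)).

Definition ball_volume (s : nat) : R :=
  fine (lebesgue_outer [set x : 'rV[R]_s | enorm x <= 1]%R).

(* [ball_volume s * (diam X / 2) ^+ s] for sets of diameter at most [delta]. *)
Definition hausdorff_gauge d s (delta : R) (X : set 'rV[R]_d) : \bar R :=
  if `[< forall x y, X x -> X y -> enorm (x - y) <= delta >]%R then
    ereal_sup (0 |` [set (ball_volume s * (enorm (xy.1 - xy.2) / 2) ^+ s)%R%:E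
                    | xy in X `*` X])
  else +oo.

Definition hausdorff_outer d s (X : set 'rV[R]_d) : \bar R :=
  ereal_sup [set cover_measure (hausdorff_gauge s delta) X
            | delta in [set delta : R | 0 < delta]%R].

Lemma hausdorff_gauge_ge0 d s delta (X : set 'rV[R]_d) :
  0 <= hausdorff_gauge s delta X.
Proof.
rewrite /hausdorff_gauge; case: ifP => // _.
by apply: ereal_sup_ubound; left.
Qed.

Lemma hausdorff_outer_ge0 d s (X : set 'rV[R]_d) : 0 <= hausdorff_outer s X.
Proof.
apply: le_trans (cover_measure_ge0 (@hausdorff_gauge_ge0 d s 1%R) X) _.
by apply: ereal_sup_ubound; exists 1%R => //=.
Qed.

Lemma hausdorff_outer0 d s : hausdorff_outer s (@set0 'rV[R]_d) = 0.
Proof.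
apply/eqP; rewrite eq_le hausdorff_outer_ge0 andbT.
apply: ge_ereal_sup => _ [delta _ <-].
by rewrite cover_measure0//; exact: hausdorff_gauge_ge0.
Qed.

Lemma le_hausdorff_outer d s :
  {homo @hausdorff_outer d s : A B / A `<=` B >-> A <= B}.
Proof.
move=> A B AB; apply: ge_ereal_sup => _ [delta delta0 <-].
apply: le_trans (le_cover_measure (hausdorff_gauge s delta) AB) _.
by apply: ereal_sup_ubound; exists delta.
Qed.

Lemma hausdorff_outer_sigma_subadditive d s :
  sigma_subadditive (@hausdorff_outer d s).
Proof.
move=> F; apply: ge_ereal_sup => _ [delta delta0 <-].
apply: le_trans (cover_measure_sigma_subadditive
  (@hausdorff_gauge_ge0 d s delta) F) _.
apply: lee_nneseries => [n _ _|n _].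
  by apply: cover_measure_ge0; exact: hausdorff_gauge_ge0.
by apply: ereal_sup_ubound; exists delta.
Qed.

HB.instance Definition _ d s :=
  isOuterMeasure.Build R 'rV[R]_d (@hausdorff_outer d s)
    (hausdorff_outer0 d s) (@hausdorff_outer_ge0 d s)
    (@le_hausdorff_outer d s) (@hausdorff_outer_sigma_subadditive d s).

End EuclideanMeasures.

Section ComplexIntegration.
Context (R : realType) (d : nat).
Local Notation E := 'rV[R]_d.

Definition cmod (z : R[i]) : R := complex.Re `|z|.

(* The complete measure induced by an outer measure on its Caratheodory
   sigma-algebra. *)
Definition cara (mu : {outer_measure set E -> \bar R}) :
    {measure set (caratheodory_type mu) -> \bar R} :=
  [the {measure set (caratheodory_type mu) -> \bar R} of
   (mu : set (caratheodory_type mu) -> \bar R)].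

Definition leb : {outer_measure set E -> \bar R} :=
  [the {outer_measure set E -> \bar R} of @lebesgue_outer R d].

Definition surf : {outer_measure set E -> \bar R} :=
  [the {outer_measure set E -> \bar R} of @hausdorff_outer R d d.-1].

Context (mu : {outer_measure set E -> \bar R}).

Definition cint (A : set E) (f : E -> R[i]) : R[i] :=
  Rintegral (cara mu) A (fun x => complex.Re (f x)) +i*
  Rintegral (cara mu) A (fun x => complex.Im (f x)).

Definition normsqL2 (A : set E) (f : E -> R[i]) : \bar R :=
  (\int[cara mu]_(x in A) (cmod (f x) ^+ 2)%:E)%E.

Definition L2 (A : set E) (f : E -> R[i]) : Prop :=
  [/\ measurable_fun (A : set (caratheodory_type mu))
        (fun x => complex.Re (f x)),
      measurable_fun (A : set (caratheodory_type mu))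
        (fun x => complex.Im (f x)) &
      (normsqL2 A f < +oo)%E].

Definition ae_eq_on (A : set E) (f g : E -> R[i]) : Prop :=
  {ae cara mu, forall x, A x -> f x = g x}.

End ComplexIntegration.

Arguments leb {R d}.
Arguments surf {R d}.

Section Sobolev.
Context (R : realType) (d : nat).
Local Notation E := 'rV[R]_d.
Implicit Types (Omega Gamma A : set E) (u w f g : E -> R[i]).

Definition partial (i : 'I_d) (phi : E -> R) : E -> R :=
  fun x => 'D_(delta_mx 0 i) phi x.

Definition smooth (phi : E -> R) : Prop :=
  forall s : seq 'I_d, let psi := foldr partial phi s in
    continuous psi /\ (forall i x, derivable psi x (delta_mx 0 i)).

Definition test_fun Omega (phi : E -> R) : Prop :=
  let supp := closure [set x | phi x != 0] in
  [/\ smooth phi, compact supp & supp `<=` Omega].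

Definition ctest_fun Omega (phi : E -> R[i]) : Prop :=
  test_fun Omega (fun x => complex.Re (phi x)) /\
  test_fun Omega (fun x => complex.Im (phi x)).

Definition weak_partial Omega u (i : 'I_d) p : Prop :=
  forall phi, test_fun Omega phi ->
    cint leb Omega (fun x => u x * (partial i phi x)%:C) =
    - cint leb Omega (fun x => p x * (phi x)%:C).

Definition is_grad Omega u (p : 'I_d -> E -> R[i]) : Prop :=
  forall i, L2 leb Omega (p i) /\ weak_partial Omega u i (p i).

Definition H1 Omega u : Prop :=
  L2 leb Omega u /\ exists p, is_grad Omega u p.

Definition grad Omega u : 'I_d -> E -> R[i] :=
  xget (fun _ _ => 0) [set p | is_grad Omega u p].

Definition normsqH1 Omega u : \bar R :=
  (normsqL2 leb Omega u + \sum_(i < d) normsqL2 leb Omega (grad Omega u i))%E.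

Definition cvgH1 Omega (phi : nat -> E -> R[i]) u : Prop :=
  (fun n => normsqH1 Omega (fun x => phi n x - u x)) @ \oo --> 0%E.

Definition H10 Omega u : Prop :=
  H1 Omega u /\
  exists phi : nat -> E -> R[i],
    (forall n, ctest_fun Omega (phi n)) /\ cvgH1 Omega phi u.

(* [g] is the trace on [Gamma], part of the boundary of [Omega], of the H^1
   function [u]: the trace operator is the continuous extension of the
   restriction map phi |-> phi|_Gamma. *)
Definition is_trace Omega Gamma u g : Prop :=
  [/\ H1 Omega u, L2 surf Gamma g &
    exists phi : nat -> E -> R[i],
      [/\ forall n, ctest_fun setT (phi n), cvgH1 Omega phi u &
          (fun n => normsqL2 surf Gamma (fun x => phi n x - g x))
            @ \oo --> 0%E]].

Definition trace Omega Gamma u : E -> R[i] :=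
  xget (fun=> 0) [set g | is_trace Omega Gamma u g].

Definition grad_form Omega u w : R[i] :=
  cint leb Omega (fun x => \sum_i grad Omega u i x * (grad Omega w i x)^*).

Definition is_laplacian Omega u f : Prop :=
  [/\ H1 Omega u, L2 leb Omega f &
    forall phi, test_fun Omega phi ->
      cint leb Omega (fun x => \sum_i grad Omega u i x * (partial i phi x)%:C) =
      - cint leb Omega (fun x => f x * (phi x)%:C)].

Definition laplacian Omega u : E -> R[i] :=
  xget (fun=> 0) [set f | is_laplacian Omega u f].

(* [f] = - Delta_Dir [u] *)
Definition dirichlet_laplacian Omega u f : Prop :=
  H10 Omega u /\ is_laplacian Omega u (fun x => - f x).

Definition resolvent_set Omega : set R[i] :=
  [set lambda |
    (forall u, dirichlet_laplacian Omega u (fun x => lambda * u x) ->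
       ae_eq_on leb Omega u (fun=> 0)) /\
    (exists K : R, forall f, L2 leb Omega f ->
       exists u, dirichlet_laplacian Omega u (fun x => lambda * u x + f x) /\
         (normsqL2 leb Omega u <= K%:E * normsqL2 leb Omega f)%E)].

Definition spectrum Omega : set R[i] := ~` resolvent_set Omega.

Definition dist_set (z : R[i]) (S : set R[i]) : \bar R :=
  ereal_inf [set (cmod (z - z'))%:E | z' in S].

(* [f] = - Delta_Neu [u], the operator of the form [grad_form] on H^1 *)
Definition neumann_laplacian Omega u f : Prop :=
  [/\ H1 Omega u, L2 leb Omega f &
    forall w, H1 Omega w ->
      grad_form Omega u w = cint leb Omega (fun x => f x * (w x)^*)].

Definition neumann_eigenspace Omega (lambda : R) : set (E -> R[i]) :=
  [set u | neumann_laplacian Omega u (fun x => lambda%:C * u x)].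

Definition orthonormal_basis Omega (V : set (E -> R[i])) m
    (u : 'I_m -> E -> R[i]) : Prop :=
  [/\ forall l, V (u l),
      forall l l', cint leb Omega (fun x => u l x * (u l' x)^*) = (l == l')%:R &
      forall w, V w -> exists c : 'I_m -> R[i],
        ae_eq_on leb Omega w (fun x => \sum_l c l * u l x)].

Definition boundary A : set E := closure A `\` interior A.

Definition C11_fun (h : E -> R) : Prop :=
  (forall i x, derivable h x (delta_mx 0 i)) /\
  exists K : R, forall i x y,
    `|partial i h x - partial i h y| <= K * enorm (x - y).

(* Near each boundary point the domain is the part lying above the graph of a
   C^{1,1} function over the hyperplane orthogonal to [n]. *)
Definition C11_domain A : Prop :=
  [/\ open A, A !=set0, connected A, exists M, forall x, A x -> enorm x <= M &
    forall x, boundary A x ->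
      exists (rho : R) (n : E) (h : E -> R),
        [/\ 0 < rho, enorm n = 1, C11_fun h &
          forall y, enorm (y - x) < rho ->
            (A y <-> h (y - dotv y n *: n) < dotv y n)]].

End Sobolev.

Section Ell2.
Context (R : realType) (I : choiceType).
Implicit Types (x y : I -> R[i]) (A B : (I -> R[i]) -> I -> R[i]).

Definition ell2_norm x : \bar R :=
  sqrte (\esum_(i in setT) (cmod (x i) ^+ 2)%:E)%E.

Definition ell2 : set (I -> R[i]) := [set x | (ell2_norm x < +oo)%E].

(* unconditional sums, meaningful for absolutely summable families *)
Definition rsum (a : I -> R) : R :=
  fine (\esum_(i in setT) (Num.max (a i) 0)%:E)%E -
  fine (\esum_(i in setT) (Num.max (- a i) 0)%:E)%E.

Definition csum x : R[i] :=
  rsum (fun i => complex.Re (x i)) +i* rsum (fun i => complex.Im (x i)).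

Definition ell2_inner x y : R[i] := csum (fun i => x i * (y i)^*).

Definition ell2_op_norm A : \bar R :=
  ereal_sup [set ell2_norm (A x) | x in [set x | (ell2_norm x <= 1)%E]].

Definition bounded_operator A : Prop :=
  [/\ forall (a : R[i]) x y, ell2 x -> ell2 y ->
        A (fun i => a * x i + y i) = (fun i => a * A x i + A y i),
      forall x, ell2 x -> ell2 (A x) &
      (ell2_op_norm A < +oo)%E].

Definition is_adjoint A B : Prop :=
  bounded_operator B /\
  forall x y, ell2 x -> ell2 y -> ell2_inner (A x) y = ell2_inner x (B y).

Definition entry A (i j : I) : R[i] := A (fun k => (k == j)%:R) i.

Definition op_sub A B : (I -> R[i]) -> I -> R[i] := fun x i => A x i - B x i.

Definition op_half_sum A B : (I -> R[i]) -> I -> R[i] :=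
  fun x i => 2^-1 * (A x i + B x i).

End Ell2.

Section Crystal.
Context (R : realType) (d : nat).
Local Notation E := 'rV[R]_d.

(* The lattice point j_1 e_1 + ... + j_d e_d is represented by its coordinate
   vector; the e_i are the rows of [basis]. *)
Local Notation site := 'rV[int]_d.

Record crystal := Crystal {
  basis : 'M[R]_d;
  inclusion : set E;
  inclusion_def : set E;
  speed : R;
  speed_in : R;
  speed_def : R;
  shape_sites : set site;
  material_sites : set site }.

Variable G : crystal.

Definition point (j : site) : E := map_mx intr j *m basis G.

Definition unit_cell : set E :=
  [set x | exists c : E, (forall i, 0 <= c 0 i < 1) /\ x = c *m basis G].

Definition compactly_included (A B : set E) : Prop :=
  compact (closure A) /\ closure A `<=` B.

Definition admissible : Prop :=
  [/\ row_free (basis G),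
      C11_domain (inclusion G) /\ compactly_included (inclusion G) unit_cell,
      C11_domain (inclusion_def G) /\
        compactly_included (inclusion_def G) unit_cell &
      [/\ 0 < speed G, 0 < speed_in G & 0 < speed_def G]].

Definition defect_sites : set site := shape_sites G `|` material_sites G.

Definition Dom (j : site) : set E :=
  [set x + point j
  | x in if j \in shape_sites G then inclusion_def G else inclusion G].

Definition speed_at (j : site) : R :=
  if j \in material_sites G then speed_def G else speed_in G.

Definition exterior (S : set site) : set E :=
  ~` closure (\bigcup_(j in S) Dom j).

Definition site_dist (j k : site) : R := enorm (point j - point k).

Definition site_cluster (j : site) (L : nat) : set site :=
  [set k | site_dist k j <= L%:R].

(* [w] has trace [g] on the boundary of [Dom j] and trace zero on the
   boundaries of the other inclusions in [S]. *)
Definition has_boundary_data (S : set site) (j : site) w g : Prop :=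
  is_trace (exterior S) (boundary (Dom j)) w g /\
  forall k, S k -> k != j ->
    is_trace (exterior S) (boundary (Dom k)) w (fun=> 0).

Definition exterior_solution (S : set site) (lambda : R[i]) (j : site)
    (u U : E -> R[i]) : Prop :=
  is_laplacian (exterior S) U (fun x => - (lambda * U x)) /\
  exists g, is_trace (Dom j) (boundary (Dom j)) u g /\
    has_boundary_data S j U g.

(* The weak normal derivative of [U] on the boundary of [Dom j], as an
   antilinear functional: by Green's formula it pairs with the trace of [w] to
   this value when [w] vanishes on the rest of the boundary. The sign comes
   from nu pointing out of [Dom j], hence into the exterior domain. *)
Definition green (S : set site) (U w : E -> R[i]) : R[i] :=
  - (grad_form (exterior S) U w +
     cint leb (exterior S) (fun x => laplacian (exterior S) U x * (w x)^*)).

Definition normal_pairing (S : set site) (j : site) (U u : E -> R[i]) : R[i] :=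
  xget 0 [set c | exists w g, [/\ has_boundary_data S j w g,
    is_trace (Dom j) (boundary (Dom j)) u g & c = green S U w]].

(* the density of the weak normal derivative with respect to surface measure *)
Definition normal_derivative (S : set site) (j : site) (U : E -> R[i]) :
    E -> R[i] :=
  xget (fun=> 0) [set h | L2 surf (boundary (Dom j)) h /\
    forall w g, has_boundary_data S j w g ->
      cint surf (boundary (Dom j)) (fun x => h x * (g x)^*) = green S U w].

Definition mode_index (m : site -> nat) : choiceType :=
  {j : site & 'I_(m j)}.

Section Capacitance.
Context (omega0 : R) (m : site -> nat) (u : forall j, 'I_(m j) -> E -> R[i]).

Definition is_neumann_basis : Prop :=
  forall j, orthonormal_basis (Dom j)
    (neumann_eigenspace (Dom j) (omega0 ^+ 2 / speed_at j ^+ 2)) (@u j).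

Definition capacitance_prefactor (p q : mode_index m) : R[i] :=
  - (speed_at (tag p) * speed_at (tag q) / (2 * omega0))%:C.

Definition capacitance_entry (U : mode_index m -> E -> R[i])
    (p q : mode_index m) : R[i] :=
  let bd := boundary (Dom (tag p)) in
  capacitance_prefactor p q *
  cint surf bd (fun x => normal_derivative setT (tag p) (U q) x *
    (trace (Dom (tag p)) bd (u (tagged p)) x)^*).

Definition cluster_entry (N L : nat) (U : mode_index m -> E -> R[i])
    (p q : mode_index m) : R[i] :=
  if site_dist (tag p) (tag q) <= N%:R then
    capacitance_prefactor p q *
    normal_pairing (site_cluster (tag q) L) (tag p) (U q) (u (tagged p))
  else 0.

End Capacitance.

End Crystal.

(* Main.v *)
Require Import Defs.
From mathcomp Require Import all_boot all_order all_algebra.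
From mathcomp Require Import complex.
From mathcomp Require Import all_classical all_reals all_analysis.
From mathcomp Require Import ring lra.
Import Order.TTheory GRing.Theory Num.Theory.
Import numFieldNormedType.Exports.

(** The assumed bound splits into three errors.  The truncation error
    [expR (- (beta * N))] does not involve the shift [gamma]; the other two pull
    in opposite directions: symmetrising leaves an error [gamma ^+ 2] from the
    complex shift, while cutting the crystal to a cluster of radius [L] costs
    [gamma^-1 * expR (- (mu * L))].  They balance when
    [gamma ^+ 3 = expR (- (mu * L))], that is [gamma = expR (- (mu * L / 3))],
    and each then equals [expR (- (2 * mu * L / 3))] ([shift_errors_balance]).
    The total is thus at most [2 * C0] times the claimed rate.  This shift tends
    to 0 as [L] grows, so it lies in the range [0 < gamma <= gamma0] where the
    bound is available as soon as [L] is large ([expR_natM_eventually_le]). *)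

Set Implicit Arguments.
Unset Strict Implicit.
Unset Printing Implicit Defensive.

Local Open Scope classical_set_scope.
Local Open Scope ring_scope.
Local Open Scope complex_scope.

Lemma shift_errors_balance (R : realType) (t : R) :
  expR (- (t / 3)) ^+ 2 = expR (- (2 * t / 3)) /\
  (expR (- (t / 3)))^-1 * expR (- t) = expR (- (2 * t / 3)).
Proof.
split.
- by rewrite expr2 -expRD; congr expR; field.
- by rewrite -expRN -expRD; congr expR; field.
Qed.

Lemma expR_natM_eventually_le (R : realType) (a eps : R) :
  0 < a -> 0 < eps ->
  exists n0 : nat, forall n : nat, (n0 <= n)%N -> expR (- (a * n%:R)) <= eps.
Proof.
move=> a0 eps0; exists (Num.bound `|ln eps / a|) => n hn.
rewrite -[leRHS](lnK (x := eps)) ?posrE// ler_expR lerNl.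
have : - (ln eps / a) <= n%:R.
  have /ltW hb := archi_boundP (normr_ge0 (ln eps / a)).
  apply: le_trans (ler_norm _) _; rewrite normrN.
  by apply: le_trans hb _; rewrite ler_nat.
by rewrite -mulNr ler_pdivrMr// mulrC.
Qed.

Theorem corollary4p9 (R : realType) (d : nat) (hd : d = 2%N \/ d = 3%N)
  (G : crystal R d) (hG : admissible G)
  (* resonant modes *)
  (omega0 : R) (homega0 : omega0 != 0)
  (m : 'rV[int]_d -> nat) (u : forall j, 'I_(m j) -> 'rV[R]_d -> R[i])
  (hu : is_neumann_basis G omega0 u)
  (hm0 : forall j, ~ defect_sites G j -> m j = 0%N)
  (hm1 : exists k, defect_sites G k /\ (0 < m k)%N)
  (* capacitance operator *)
  (U : mode_index m -> 'rV[R]_d -> R[i])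
  (hU : forall q : mode_index m, exterior_solution G setT
          (omega0 ^+ 2 / speed G ^+ 2)%:C (tag q) (u _ (tagged q)) (U q))
  (Cap : (mode_index m -> R[i]) -> mode_index m -> R[i])
  (hCap_bounded : bounded_operator Cap) (hCap_selfadjoint : is_adjoint Cap Cap)
  (hCap : forall p q, entry Cap p q = capacitance_entry G omega0 u U p q)
  (* complex shift *)
  (r gamma0 : R) (hr : 0 < r)
  (hball : forall z : R[i], `|z - (omega0 ^+ 2)%:C| <= r%:C ->
     resolvent_set (exterior G setT) (z / (speed G ^+ 2)%:C))
  (hgamma0 : 0 < gamma0 < r)
  (* finite clusters *)
  (V : nat -> R -> mode_index m -> 'rV[R]_d -> R[i])
  (hV : forall L gamma (q : mode_index m), (1 <= L)%N -> 0 < gamma <= gamma0 ->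
     exterior_solution G (site_cluster G (tag q) L)
       ((omega0 ^+ 2 +i* gamma) / (speed G ^+ 2)%:C)
       (tag q) (u _ (tagged q)) (V L gamma q))
  (Cfc Cfc_adj : nat -> nat -> R ->
     (mode_index m -> R[i]) -> mode_index m -> R[i])
  (hCfc_bounded : forall N L gamma, (1 <= N <= L)%N -> 0 < gamma <= gamma0 ->
     bounded_operator (Cfc N L gamma))
  (hCfc : forall N L gamma, (1 <= N <= L)%N -> 0 < gamma <= gamma0 ->
     forall p q, entry (Cfc N L gamma) p q =
       cluster_entry G omega0 u N L (V L gamma) p q)
  (hCfc_adj : forall N L gamma, (1 <= N <= L)%N -> 0 < gamma <= gamma0 ->
     is_adjoint (Cfc N L gamma) (Cfc_adj N L gamma))
  (* exterior gap condition *)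
  (hgap : (0 < dist_set (omega0 ^+ 2 / speed G ^+ 2)%:C
                 (spectrum (exterior G setT)))%E)
  (C0 beta mu : R) (hC0 : 0 < C0) (hbeta : 0 < beta) (hmu : 0 < mu)
  (hbound : forall (N L : nat) (gamma : R), (1 <= N <= L)%N ->
     0 < gamma <= gamma0 ->
     (ell2_op_norm (op_sub Cap
        (op_half_sum (Cfc N L gamma) (Cfc_adj N L gamma))) <=
      (C0 * (gamma ^+ 2 + expR (- (beta * N%:R)) +
             gamma^-1 * expR (- (mu * L%:R))))%:E)%E) :
  exists C : R, 0 < C /\
  exists L0 : nat, forall L N : nat, (L0 <= L)%N -> (1 <= N <= L)%N ->
    let gammaL := expR (- (mu * L%:R / 3)) in
    (ell2_op_norm (op_sub Cap
       (op_half_sum (Cfc N L gammaL) (Cfc_adj N L gammaL))) <=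
     (C * (expR (- (beta * N%:R)) + expR (- (2 * mu * L%:R / 3))))%:E)%E.
Proof.
have [L0 shift_le] : exists L0 : nat, forall L : nat, (L0 <= L)%N ->
    expR (- (mu * L%:R / 3)) <= gamma0.
  have [gamma0_gt0 _] := andP hgamma0.
  have mu3_gt0 : 0 < mu / 3 by rewrite divr_gt0.
  have [L0 hL0] := expR_natM_eventually_le mu3_gt0 gamma0_gt0.
  by exists L0 => L /hL0; rewrite mulrAC.
exists (2 * C0); split; first by rewrite mulr_gt0.
exists L0 => L N L0L hNL; cbv zeta.
have gammaL_range : 0 < expR (- (mu * L%:R / 3)) <= gamma0 by rewrite expR_gt0 shift_le.
apply: le_trans (hbound N L _ hNL gammaL_range) _; rewrite lee_fin.
have [-> ->] := shift_errors_balance (mu * L%:R).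
rewrite mulrA.
have := mulr_gt0 hC0 (expR_gt0 (- (beta * N%:R))).
lra.
Qed.
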